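(* There is an algorithm for solving the hidden database crawling problem whose cost, where $n=|D|$ is the number of tuples in the hidden database $D$, is: (1) $O\left(d\cdot\frac{n}{k}\right)$ when the data space $\mathbb{D}$ is numeric; (2) at most $U_1$ when $\mathbb{D}$ is categorical and $cat=1$ (i.e., there is only one categorical attribute, so $d=1$); (3) at most $\frac{n}{k}\cdot\sum_{i=1}^{d}\min\{U_i,\frac{n}{k}\}+\sum_{i=1}^{d}U_i$ when $\mathbb{D}$ is categorical and $cat>1$; (4) at most $U_1+O\left(d\cdot\frac{n}{k}\right)$ when $\mathbb{D}$ is mixed and $cat=1$; (5) otherwise (i.e., $\mathbb{D}$ is mixed and $cat>1$), at most $\frac{n}{k}\cdot\sum_{i=1}^{cat}\min\{U_i,\frac{n}{k}\}+\sum_{i=1}^{cat}U_i+O\left((d-cat)\frac{n}{k}\right)$.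
   Context: Data space: there are $d\ge 1$ attributes $A_1,\dots,A_d$ and $\mathbb{D}=dom(A_1)\times\cdots\times dom(A_d)$; elements of $\mathbb{D}$ are called points. A numeric attribute has as domain the set of all integers; a categorical attribute $A_i$ has a finite domain of size $U_i$, identified with $\{1,\dots,U_i\}$ (the ordering is irrelevant). $\mathbb{D}$ is numeric if all attributes are numeric; categorical if all are categorical (the number $cat$ of categorical attributes is then $d$); mixed if $A_1,\dots,A_{cat}$ are categorical and $A_{cat+1},\dots,A_d$ are numeric for some $cat\in[1,d-1]$. Hidden database: a finite bag (multiset) $D$ of $n$ elements of $\mathbb{D}$, called tuples. For the system parameter $k$ (a positive integer), it is required throughout that no point of $\mathbb{D}$ occurs in $D$ more than $k$ times. Queries: a query $q$ specifies one predicate per attribute: $A_i\in[x,y]$ for an interval of integers (possibly unbounded, e.g. $(-\infty,\infty)$) if $A_i$ is numeric; $A_i=x$ with $x\in dom(A_i)$ or $x=\star$ (wildcard, no constraint) if $A_i$ is categorical. $q(D)$ is the bag of tuples of $D$ satisfying all predicates of $q$. Server response: if $|q(D)|\le k$, the whole $q(D)$ is returned (the query is resolved); otherwise only $k$ tuples of $q(D)$, chosen by the server, are returned together with a signal that $q(D)$ has other tuples (the query overflows). Repeating an overflowing query may always return the same response. Hidden database crawling problem: retrieve the entire bag $D$ by issuing queries to the server, while minimizing the number of queries. The algorithm knows $k$ and the attributes with their domains, but not $D$. The cost of an algorithm is the number of queries it issues.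
   Formalization: In case (1), n/k inside the O(.) is read as max(1, n/k): for n < k the literal bound fails (for n = 0 it would allow no query, yet one is needed to know that D is empty); for n at least k the bound is unchanged. *)

(* Defs.v *)
From mathcomp Require Import all_boot all_order all_algebra.

Set Implicit Arguments.
Unset Strict Implicit.
Unset Printing Implicit Defensive.

Import Order.TTheory GRing.Theory Num.Theory.
Local Open Scope ring_scope.

(* The attributes are listed with the categorical ones first: [ncat] of them,
   the i-th with domain size [domsize i], followed by [nnum] numeric ones. *)
Record data_space := DataSpace {
  ncat : nat;
  nnum : nat;
  domsize : 'I_ncat -> nat
}.

Definition ndim (S : data_space) : nat := (ncat S + nnum S)%N.

Definition numeric (S : data_space) : bool := ncat S == 0%N.
Definition categorical (S : data_space) : bool := ncat S == ndim S.
Definition mixed (S : data_space) : bool := (0 < ncat S < ndim S)%N.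

(* The domain {1, ..., U_i} is represented by the ordinals 0, ..., U_i - 1. *)
Definition point (S : data_space) : Type :=
  ({dffun forall i : 'I_(ncat S), 'I_(domsize i)} * {ffun 'I_(nnum S) -> int})%type.

(* [None] is the wildcard of a categorical predicate. *)
Record query (S : data_space) := Query {
  cat_pred : forall i : 'I_(ncat S), option 'I_(domsize i);
  num_pred : 'I_(nnum S) -> interval int
}.

Definition satisfies (S : data_space) (q : query S) (t : point S) : bool :=
  [forall i : 'I_(ncat S), if cat_pred q i is Some x then t.1 i == x else true]
  && [forall j : 'I_(nnum S), t.2 j \in num_pred q j].

(* Bags are represented by sequences, considered up to [perm_eq]. *)
Definition matches (S : data_space) (q : query S) (D : seq (point S)) :
    seq (point S) :=
  [seq t <- D | satisfies q t].

Record response (S : data_space) := Response {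
  returned : seq (point S);
  overflow : bool
}.

Definition valid_response (S : data_space) (k : nat) (D : seq (point S))
    (q : query S) (r : response S) : Prop :=
  if (size (matches q D) <= k)%N then
    overflow r = false /\ perm_eq (returned r) (matches q D)
  else
    [/\ overflow r = true,
        size (returned r) = k &
        forall t : point S,
          (count_mem t (returned r) <= count_mem t (matches q D))%N].

Definition history (S : data_space) : Type := seq (query S * response S).

(* The server's choice may depend on everything that happened before; servers
   that answer a repeated query identically are a special case. *)
Definition server (S : data_space) : Type :=
  history S -> query S -> response S.

Definition valid_server (S : data_space) (k : nat) (D : seq (point S))
    (srv : server S) : Prop :=
  forall (h : history S) (q : query S), valid_response k D q (srv h q).

Inductive action (S : data_space) :=
  | Ask of query S
  | Output of seq (point S).

(* An adaptive deterministic algorithm: what it does next is a function of the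
   queries issued and the responses received so far (oldest first). It need not
   terminate on histories that no finite database can produce. *)
Definition algorithm (S : data_space) : Type := history S -> action S.

(* [run A srv h out c]: started from history [h], the algorithm issues exactly
   [c] further queries and then terminates with output [out]. *)
Inductive run (S : data_space) (A : algorithm S) (srv : server S) :
    history S -> seq (point S) -> nat -> Prop :=
  | run_output h out : A h = Output out -> run A srv h out 0
  | run_ask h q out c :
      A h = Ask q -> run A srv (rcons h (q, srv h q)) out c ->
      run A srv h out c.+1.

(* Main.v *)
(** First ask all [sum U_i] slice queries (one categorical attribute fixed). Then
explore the tree that fixes the categorical attributes one by one, descending
only below overflowing nodes; a child lying in a resolved slice is answered from
that slice. Each level has fewer than [n / k] overflowing nodes, each asking at
most min(U_i, n / k) children, since an overflowing slice has more than [k]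
tuples. The root is not asked, and the first level consists of slices.

Once the categorical attributes are fixed, an overflowing query is split on a
numeric attribute at the median [v] of the [k] returned tuples. If at least [k / 4]
of them lie below [v], the split into [< v] and [>= v] leaves [k / 4] tuples on
both sides. Otherwise at least [k / 4] have the value [v], and the split into [< v],
[= v], [> v] is charged to the tuples of the middle part, which lose a dimension.
With [j] dimensions left and [m] tuples, this takes at most [20 j m / k] queries
below a node. *)

Require Import Defs.
From mathcomp Require Import all_boot all_order all_algebra.
From mathcomp Require Import zify lra.

Set Implicit Arguments.
Unset Strict Implicit.
Unset Printing Implicit Defensive.

Import Order.TTheory GRing.Theory Num.Theory.
Local Open Scope ring_scope.

(** * Counting in fibers, sub-bags and sorted sequences *)

Lemma perm_flatten_fibers (T : eqType) (B : finType) (f : T -> B) (s : seq T) :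
  perm_eq (flatten [seq [seq t <- s | f t == x] | x <- enum B]) s.
Proof.
apply/permP=> a; rewrite count_flatten -map_comp sumnE big_map big_enum /=.
elim: s => [|t s IHs] /=; first by rewrite big1.
rewrite -IHs [RHS]addnC -[in RHS](muln1 (a t)).
rewrite (bigD1 (f t)) //= eqxx /= [in RHS](bigD1 (f t)) //= muln1 [RHS]addnC addnA.
by congr (_ + _)%N; apply: eq_bigr => x /negPf; rewrite eq_sym => ->.
Qed.

Lemma count_mem_le (T : eqType) (s1 s2 : seq T) (a : pred T) :
  (forall t, (count_mem t s1 <= count_mem t s2)%N) ->
  (count a s1 <= count a s2)%N.
Proof.
by move=> /count_subseqP[s ss2 /permP ->]; apply: leq_count_subseq.
Qed.

Lemma count_le_nth_sort d (T : orderType d) (x0 : T) (s : seq T) (n : nat) :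
  (n < size s)%N ->
  (n < count (fun y => y <= nth x0 (sort <=%O s) n)%O s)%N.
Proof.
move=> ns; have ps := permP (permEl (perm_sort <=%O s)); rewrite -ps.
have := sort_sorted le_total s.
set u := sort _ s => ou; have nu : (n < size u)%N by rewrite size_sort.
clear ps; clearbody u.
rewrite -[X in count _ X](cat_take_drop n.+1) count_cat.
apply: leq_trans (leq_addr _ _); rewrite (_ : count _ _ = size (take n.+1 u)).
  by rewrite size_take_min; lia.
apply/eqP; rewrite -all_count; apply/(all_nthP x0) => i.
rewrite size_take_min => iu; rewrite nth_take; last lia.
have [lt_i le_i] : (i < size u)%N /\ (i <= n)%N by lia.
exact: (sorted_leq_nth le_trans le_refl x0 ou) lt_i nu le_i.
Qed.

Lemma count_ge_nth_sort d (T : orderType d) (x0 : T) (s : seq T) (n : nat) :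
  (size s <= n + count (fun y => nth x0 (sort <=%O s) n <= y)%O s)%N.
Proof.
have ps := permP (permEl (perm_sort <=%O s)); rewrite -ps.
have := sort_sorted le_total s.
set u := sort _ s => ou; have su : size u = size s by rewrite size_sort.
case: (ltnP n (size s)) => ns; last lia.
clear ps; clearbody u.
rewrite -[X in count _ X](cat_take_drop n) count_cat.
suff -> : count (fun y => nth x0 u n <= y)%O (drop n u) = size (drop n u).
  by rewrite size_drop; lia.
apply/eqP; rewrite -all_count; apply/(all_nthP x0) => i.
rewrite size_drop => iu; rewrite nth_drop.
have [lt_n lt_ni] : (n < size u)%N /\ (n + i < size u)%N by lia.
exact: (sorted_leq_nth le_trans le_refl x0 ou) lt_n lt_ni (leq_addr i n).
Qed.

(** * The crawling algorithm *)

Section Algorithm.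

Variables (S : data_space) (k : nat).

Definition slice : finType := {i : 'I_(ncat S) & 'I_(domsize i)}.

Definition mk_slice (i : 'I_(ncat S)) (x : 'I_(domsize i)) : slice :=
  Tagged (fun i : 'I_(ncat S) => 'I_(domsize i)) x.

Definition full_query : query S :=
  Query (fun i : 'I_(ncat S) => None : option 'I_(domsize i)) (fun=> `]-oo, +oo[).

Definition fix_cat (q : query S) (i : 'I_(ncat S)) (x : 'I_(domsize i)) :
    query S :=
  Query (dfwith (T := fun i : 'I_(ncat S) => option 'I_(domsize i))
           (cat_pred q) (Some x))
        (num_pred q).

Definition narrow (q : query S) (j : 'I_(nnum S)) (I : interval int) : query S :=
  Query (cat_pred q)
    (fun j' => if j' == j then Order.meet (num_pred q j') I else num_pred q j').

Definition slice_query (p : slice) : query S := fix_cat full_query (tagged p).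

(* The number records how many attributes, in order, are already fixed to a
   single value; the next one is split. *)
Definition node : Type := (nat * query S)%type.

(* Queries still to be asked, and tuples already found. *)
Definition work : Type := (seq node * seq (point S))%type.

Definition merge_work (ws : seq work) : work :=
  (flatten (unzip1 ws), flatten (unzip2 ws)).

Definition cat_child (tab : slice -> response S) (l : nat) (q : query S)
    (i : 'I_(ncat S)) (x : 'I_(domsize i)) : work :=
  let r := tab (mk_slice x) in
  if overflow r then ([:: (l.+1, fix_cat q x)], [::])
  else ([::], matches (fix_cat q x) (returned r)).

(** An overflowing answer has [k] tuples and [k./2 < k], so the default [0] is never read there. *)
Definition median (j : 'I_(nnum S)) (s : seq (point S)) : int :=
  nth 0 (sort <=%O [seq t.2 j | t : point S <- s]) k./2.

Definition num_children (l : nat) (q : query S) (j : 'I_(nnum S))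
    (s : seq (point S)) : seq node :=
  let v := median j s in
  if (k <= 4 * count (fun t : point S => t.2 j < v)%R s)%N then
    [:: (l, narrow q j `]-oo, v[); (l, narrow q j `[v, +oo[)]
  else
    [:: (l, narrow q j `]-oo, v[); (l.+1, narrow q j `[v, v]);
        (l, narrow q j `]v, +oo[)].

(** The subtraction is reached only when [ncat S <= l]. The last branch, an overflow with every
    attribute fixed, is excluded by the bound [k] on multiplicities. *)
Definition expand (tab : slice -> response S) (nd : node) (r : response S) :
    work :=
  let: (l, q) := nd in
  if ~~ overflow r then ([::], returned r)
  else if insub l is Some i then
    merge_work [seq cat_child tab l q x | x <- enum 'I_(domsize i)]
  else if insub (l - ncat S)%N is Some j then
    (num_children l q j (returned r), [::])
  else ([::], [::]).

(* The first-level nodes are slices, so they are expanded with the answers that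
   are already in [tab] instead of being asked again. *)
Definition initial_work (tab : slice -> response S) : work :=
  if insub 0%N is Some i then
    merge_work
      [seq expand tab (1%N, fix_cat full_query x)
         (tab (mk_slice x))
      | x : 'I_(domsize i) <- enum 'I_(domsize i)]
  else ([:: (0%N, full_query)], [::]).

(** Children go on top of the stack, so a subtree is finished before its siblings are touched. *)
Definition absorb (tab : slice -> response S) (w : work)
    (e : query S * response S) : work :=
  if w.1 is nd :: l then
    let w' := expand tab nd e.2 in (w'.1 ++ l, w.2 ++ w'.2)
  else w.

(** An algorithm sees only the history, so the stack is recomputed by replaying it. *)
Definition state (tab : slice -> response S) (h : history S) : work :=
  foldl (absorb tab) (initial_work tab) h.

Definition explore (tab : slice -> response S) : algorithm S := fun h =>
  let w := state tab h in
  if w.1 is nd :: _ then Ask nd.2 else Output w.2.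

(** The crawler reads the table only once all slices are answered, so it never meets the default. *)
Definition slice_table (h : history S) (p : slice) : response S :=
  nth (Response [::] false) (unzip2 h) (index p (enum slice)).

(* The first [#|slice|] entries of the history are the answers to the slices. *)
Definition crawler : algorithm S := fun h =>
  if drop (size h) (enum slice) is p :: _ then Ask (slice_query p)
  else explore (slice_table (take #|slice| h)) (drop #|slice| h).

End Algorithm.

(** * Effect of refining a query on its answer *)

Section Semantics.
Variable S : data_space.
Implicit Types (q : query S) (t : point S).

(** [fix_cat] overwrites the old predicate on [i]; a conjunction results because that predicate was
    the wildcard. *)
Lemma satisfies_fix_cat q i (x : 'I_(domsize i)) t : cat_pred q i = None ->
  satisfies (fix_cat q x) t = satisfies q t && (t.1 i == x).
Proof.
move=> qi; rewrite /satisfies /= -andbA [X in _ = _ && X]andbC andbA.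
congr (_ && _); apply/forallP/andP => [sat|[/forallP sat tx] i'].
  split; last by have := sat i; rewrite dfwith_in.
  apply/forallP => i'; have := sat i'.
  by case: dfwithP => // ; rewrite qi.
by case: dfwithP => // j _; apply: sat.
Qed.

Lemma satisfies_narrow q j I t :
  satisfies (narrow q j I) t = satisfies q t && (t.2 j \in I).
Proof.
rewrite /satisfies /= -andbA; congr (_ && _).
apply/forallP/andP => [sat|[/forallP sat tI] j'].
  have := sat j; rewrite eqxx in_itvI => /andP[_ ->]; split=> //.
  apply/forallP => j'; have := sat j'; case: eqP => // _.
  by rewrite in_itvI => /andP[].
by have := sat j'; case: eqP => [->|//] sj; rewrite in_itvI sj.
Qed.

Lemma satisfies_full_query t : satisfies (full_query S) t.
Proof. by apply/andP; split; apply/forallP. Qed.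

Lemma matches_full_query D : matches (full_query S) D = D.
Proof. by apply/all_filterP/allP => t _; exact: satisfies_full_query. Qed.

Lemma matches_fix_cat q i (x : 'I_(domsize i)) D : cat_pred q i = None ->
  matches (fix_cat q x) D = [seq t : point S <- matches q D | t.1 i == x].
Proof.
move=> qi; rewrite /matches -filter_predI; apply: eq_filter => t /=.
by rewrite satisfies_fix_cat // andbC.
Qed.

Lemma matches_narrow q j I D :
  matches (narrow q j I) D = [seq t : point S <- matches q D | t.2 j \in I].
Proof.
rewrite /matches -filter_predI; apply: eq_filter => t /=.
by rewrite satisfies_narrow andbC.
Qed.

Lemma perm_matches_fix_cat q i D : cat_pred q i = None ->
  perm_eq (flatten [seq matches (fix_cat q x) D | x <- enum 'I_(domsize i)])
    (matches q D).
Proof.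
move=> qi; rewrite (eq_map (fun x => matches_fix_cat x D qi)).
exact: (perm_flatten_fibers (fun t : point S => t.1 i)).
Qed.

Lemma sum_size_matches_fix_cat q i D : cat_pred q i = None ->
  (\sum_(x : 'I_(domsize i)) size (matches (fix_cat q x) D))%N
  = size (matches q D).
Proof.
move=> /(@perm_matches_fix_cat q i D)/perm_size <-.
by rewrite size_flatten /shape -map_comp sumnE big_map big_enum.
Qed.

Lemma perm_split2 q j (v : int) D :
  perm_eq (matches (narrow q j `]-oo, v[) D ++ matches (narrow q j `[v, +oo[) D)
    (matches q D).
Proof.
apply/permP => a; rewrite !count_cat !matches_narrow.
elim: (matches q D) => //= t s <-; rewrite !in_itv /= andbT.
by case: (ltP (t.2 j) v) => _ /=; lia.
Qed.

Lemma perm_split3 q j (v : int) D :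
  perm_eq (matches (narrow q j `]-oo, v[) D ++
           (matches (narrow q j `[v, v]) D ++ matches (narrow q j `]v, +oo[) D))
    (matches q D).
Proof.
apply/permP => a; rewrite !count_cat !matches_narrow.
elim: (matches q D) => //= t s <-; rewrite !in_itv /= andbT.
by case: (ltgtP (t.2 j) v) => _ /=; lia.
Qed.

End Semantics.

(** * Cost accounting for the depth-first exploration *)

Section Exploration.

Variables (S : data_space) (k : nat) (D : seq (point S)).
Variables (tab : slice S -> response S) (srv : server S).
Hypothesis k_gt0 : (0 < k)%N.
Hypothesis D_le_k : forall t : point S, (count_mem t D <= k)%N.
Hypothesis srv_valid : valid_server k D srv.
Hypothesis tab_valid : forall p, valid_response k D (slice_query p) (tab p).

(* From any history where [l] is on top of the pending queries, the exploration
   disposes of [l] with at most [b] queries, having found the tuples [X]. *)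
Definition settles (l : seq (node S)) (X : seq (point S)) (b : rat) : Prop :=
  forall h todo acc, state k tab h = (l ++ todo, acc) ->
  exists h' acc' c,
    [/\ state k tab h' = (todo, acc'), perm_eq acc' (acc ++ X), c%:R <= b &
        forall out c', run (explore k tab) srv h' out c' ->
          run (explore k tab) srv h out (c + c')].

Definition work_settles (w : work S) (X : seq (point S)) (b : rat) : Prop :=
  exists2 Y, settles w.1 Y b & perm_eq (w.2 ++ Y) X.

(* [b] does not count the query of [nd] itself. *)
Definition solves (nd : node S) (b : rat) : Prop :=
  forall r, valid_response k D nd.2 r ->
    work_settles (expand k tab nd r) (matches nd.2 D) b.

Lemma settles_nil : settles [::] [::] 0.
Proof. by move=> h todo acc sh; exists h, acc, 0%N; rewrite cats0. Qed.

Lemma settles_le l X b1 b2 : b1 <= b2 -> settles l X b1 -> settles l X b2.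
Proof.
move=> leb sl h todo acc /sl[h' [acc' [c [sh' pX cb runs]]]].
by exists h', acc', c; split=> //; apply: le_trans leb.
Qed.

Lemma settles_cat l1 l2 X1 X2 b1 b2 :
  settles l1 X1 b1 -> settles l2 X2 b2 ->
  settles (l1 ++ l2) (X1 ++ X2) (b1 + b2).
Proof.
move=> s1 s2 h todo acc; rewrite -catA.
move=> /s1[h1 [acc1 [c1 [/s2[h2 [acc2 [c2 [sh2 p2 cb2 r2]]]] p1 cb1 r1]]]].
exists h2, acc2, (c1 + c2)%N; split=> //.
- by rewrite catA (perm_trans p2) // perm_cat2r.
- by rewrite natrD lerD.
- by move=> out c' /r2/r1; rewrite addnA.
Qed.

Lemma settles_ask nd b :
  solves nd b -> settles [:: nd] (matches nd.2 D) (1 + b).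
Proof.
move=> solv h todo acc sh; have [Y sY pY] := solv _ (srv_valid h nd.2).
set r := srv h nd.2 in sY pY; set w := expand k tab nd r in sY pY.
have sh1 : state k tab (rcons h (nd.2, r)) = (w.1 ++ todo, acc ++ w.2).
  by rewrite /state foldl_rcons -/(state k tab h) sh.
have [h' [acc' [c [sh' pacc cb runs]]]] := sY _ _ _ sh1.
exists h', acc', c.+1; split=> //.
- by rewrite (perm_trans pacc) // -catA perm_cat2l.
- by rewrite -add1n natrD lerD.
- move=> out c' /runs; apply: run_ask.
  by rewrite /explore sh.
Qed.

Lemma work_settles_le w X b1 b2 :
  b1 <= b2 -> work_settles w X b1 -> work_settles w X b2.
Proof. by move=> leb [Y sY pY]; exists Y => //; apply: settles_le sY. Qed.

Lemma work_settles_perm w X1 X2 b :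
  perm_eq X1 X2 -> work_settles w X1 b -> work_settles w X2 b.
Proof. by move=> pX [Y sY pY]; exists Y => //; apply: perm_trans pX. Qed.

Lemma work_settles_output X : work_settles ([::], X) X 0.
Proof. by exists [::]; [apply: settles_nil | rewrite cats0]. Qed.

Lemma work_settles_merge (I : Type) (s : seq I) (F : I -> work S)
    (X : I -> seq (point S)) (b : I -> rat) :
  (forall i, work_settles (F i) (X i) (b i)) ->
  work_settles (merge_work [seq F i | i <- s]) (flatten [seq X i | i <- s])
    (\sum_(i <- s) b i).
Proof.
move=> sF; elim: s => [|i s [Y sY pY]] /=.
  by rewrite big_nil; apply: work_settles_output.
have [Z sZ pZ] := sF i; exists (Z ++ Y).
  by rewrite big_cons; apply: settles_cat.
apply: perm_trans (perm_cat pZ pY).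
by rewrite /= -!catA perm_cat2l perm_catCA.
Qed.

Lemma explore_run X b : work_settles (initial_work k tab) X b ->
  exists out c,
    [/\ run (explore k tab) srv [::] out c, perm_eq out X & c%:R <= b].
Proof.
move=> [Y sY pY]; have : state k tab [::] =
    ((initial_work k tab).1 ++ [::], (initial_work k tab).2).
  by rewrite cats0 -surjective_pairing.
move=> /sY[h [out [c [sh pout cb runs]]]]; exists out, c; split=> //.
  rewrite -[c]addn0; apply/runs/run_output.
  by rewrite /explore sh.
exact: perm_trans pY.
Qed.

Lemma valid_response_resolved q r : valid_response k D q r ->
  overflow r = false -> perm_eq (returned r) (matches q D).
Proof. by rewrite /valid_response; case: ifP => _ [// ->]. Qed.

Lemma valid_response_overflow q r : valid_response k D q r -> overflow r ->
  [/\ (k < size (matches q D))%N, size (returned r) = k &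
      forall a, (count a (returned r) <= count a (matches q D))%N].
Proof.
rewrite /valid_response; case: leqP => [_ [-> //]|lt_k [_ sr cr] _].
by split=> // a; apply: count_mem_le.
Qed.

(** Stated through the satisfying points, not the syntax of [q], so that it passes to every narrower
    query. *)
Definition determined (l : nat) (q : query S) : Prop :=
  forall t t' : point S, satisfies q t -> satisfies q t' ->
    (forall i : 'I_(ncat S), (i < l)%N -> t.1 i = t'.1 i) /\
    (forall j : 'I_(nnum S), (ncat S + j < l)%N -> t.2 j = t'.2 j).

Definition load (q : query S) : rat := (size (matches q D))%:R / k%:R.

Lemma load_ge0 q : 0 <= load q.
Proof. by rewrite divr_ge0. Qed.

(** Once every attribute is fixed all matches coincide, so their number is bounded by a multiplicity
    in [D]. *)
Lemma determined_resolved l q : determined l q -> (ndim S <= l)%N ->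
  (size (matches q D) <= k)%N.
Proof.
move=> det le_l; case E: (matches q D) => [//|t s]; rewrite -E.
have sat t' : t' \in matches q D -> satisfies q t'.
  by rewrite mem_filter => /andP[].
have tD : t \in matches q D by rewrite E mem_head.
apply: leq_trans (D_le_k t).
apply: leq_trans (leq_count_subseq _ (filter_subseq (satisfies q) D)).
rewrite -/(matches q D) -size_filter; apply: eq_leq; congr size.
apply/esym/all_filterP/allP => t' t'D /=; apply/eqP.
have [det1 det2] := det _ _ (sat _ t'D) (sat _ tD).
rewrite [t']surjective_pairing [t]surjective_pairing; congr (_, _).
  by apply/ffunP => i; apply: det1; apply: leq_trans le_l; rewrite ltn_addr.
by apply/ffunP => j; apply: det2; apply: leq_trans le_l; rewrite ltn_add2l.
Qed.

Lemma solves_le nd b1 b2 : b1 <= b2 -> solves nd b1 -> solves nd b2.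
Proof. by move=> leb s r /s; apply: work_settles_le. Qed.

Lemma solves_resolved nd : (size (matches nd.2 D) <= k)%N -> solves nd 0.
Proof.
move=> le_k r; case: nd le_k => l q /= le_k; rewrite /valid_response le_k.
move=> [ovf pr]; rewrite /expand ovf /=; apply: work_settles_perm pr _.
exact: work_settles_output.
Qed.

(** * Splitting on the numeric attributes *)

Lemma determined_narrow l q j I : determined l q -> determined l (narrow q j I).
Proof.
by move=> det t t'; rewrite !satisfies_narrow => /andP[st _] /andP[st' _]; apply: det.
Qed.

Lemma determined_narrow1 l q (j : 'I_(nnum S)) (v : int) : determined l q ->
  l = (ncat S + j)%N -> determined l.+1 (narrow q j `[v, v]).
Proof.
move=> det lj t t'; rewrite !satisfies_narrow !in_itv /= -!eq_le.
move=> /andP[st /eqP tv] /andP[st' /eqP tv'].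
have [det1 det2] := det _ _ st st'; split=> [i _|j' lej'].
  by apply: det1; rewrite lj ltn_addr.
have [->|nj] := eqVneq j' j; first by rewrite -tv -tv'.
apply: det2; rewrite lj ltn_add2l ltn_neqAle.
by move: nj lej'; rewrite -val_eqE /= => ->; rewrite lj ltnS leq_add2l.
Qed.

(** Only the non-strict balance survives ties at the median; the three-way split handles the
    rest. *)
Lemma median_balanced j (s : seq (point S)) : size s = k ->
  (k <= 2 * count (fun t : point S => t.2 j <= median k j s)%R s)%N /\
  (k <= 2 * count (fun t : point S => median k j s <= t.2 j)%R s)%N.
Proof.
move=> sk; set u := [seq t.2 j | t : point S <- s].
have su : size u = k by rewrite size_map.
have hk : (k./2 < size u)%N by rewrite su; lia.
have := count_le_nth_sort 0 hk; have := count_ge_nth_sort (0 : int) u k./2.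
rewrite -/(median k j s) !count_map su /= => ge_k lt_k.
split; first by move: lt_k; set c := count _ _; lia.
by move: ge_k; set c := count _ _; lia.
Qed.

Lemma count_narrow j I q r : valid_response k D q r -> overflow r ->
  (count (fun t : point S => t.2 j \in I) (returned r)
   <= size (matches (narrow q j I) D))%N.
Proof.
move=> vr /(valid_response_overflow vr)[_ _ cr].
by rewrite matches_narrow size_filter.
Qed.

Lemma size_load q : (k <= 4 * size (matches q D))%N -> 1 <= 4 * load q.
Proof.
move=> le_k; rewrite /load mulrA ler_pdivlMr ?ltr0n // mul1r.
by rewrite -natrM ler_nat.
Qed.

(** No query is made below a resolved node, so the bounds only have to be nonnegative. With load at
    least 1/4 and a dimension left, the first one is at least 5, more than the slack. *)
Lemma solves_numeric_resolved l q : (size (matches q D) <= k)%N ->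
  solves (l, q) (20 * (ndim S - l)%:R * load q) /\
  ((l < ndim S)%N -> (k <= 4 * size (matches q D))%N ->
    solves (l, q) (20 * (ndim S - l)%:R * load q - 2)).
Proof.
move=> le_k; have s0 : solves (l, q) 0 by apply: solves_resolved.
split=> [|lt_l /size_load u1]; apply: solves_le s0.
  by rewrite mulr_ge0 ?load_ge0 // mulr_ge0 ?ler0n.
have j1 : 1 <= (ndim S - l)%:R :> rat by rewrite ler1n subn_gt0.
have := ler_wpM2r (load_ge0 q) j1; lra.
Qed.

(* The slack [- 2] pays for the queries of the two children of a two-way split,
   both of which have at least [k / 4] tuples. In a three-way split, the decrease
   of [20 * load] by at least 5 in the middle pays for 3 queries and the slack. *)
Lemma solves_numeric N l q :
  (ncat S <= l)%N -> determined l q ->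
  (size (matches q D) + (ndim S - l) <= N)%N ->
  solves (l, q) (20 * (ndim S - l)%:R * load q) /\
  ((l < ndim S)%N -> (k <= 4 * size (matches q D))%N ->
    solves (l, q) (20 * (ndim S - l)%:R * load q - 2)).
Proof.
(* The measure drops: both parts of a two-way split are nonempty, and so is the middle part of a
   three-way one, hence the other parts shrink; the middle part uses up a dimension. *)
elim: N l q => [|N IHN] l q le_l det leN.
  by apply: solves_numeric_resolved; lia.
have [/solves_numeric_resolved//|lt_k] := leqP (size (matches q D)) k.
have lt_l : (l < ndim S)%N.
  by rewrite ltnNge; apply/negP => /(determined_resolved det); lia.
suff solv : solves (l, q) (20 * (ndim S - l)%:R * load q - 2).
  by split=> // ; apply: solves_le solv; lra.
move=> r vr; have ovf : overflow r.
  by move: vr; rewrite /valid_response /= leqNgt lt_k => -[].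
have [_ szr _] := valid_response_overflow vr ovf.
have lj : (l - ncat S < nnum S)%N by rewrite /ndim in lt_l; lia.
pose j := Ordinal lj; have lE : l = (ncat S + j)%N by rewrite /=; lia.
have insub_j : insub (l - ncat S)%N = Some j by apply: insubT.
rewrite /expand ovf /= insubN -?leqNgt // insub_j.
rewrite /num_children; set v := median k j (returned r).
have [cle cge] := median_balanced j szr.
rewrite -/v in cle cge.
have szlt : (count (fun t : point S => t.2 j < v)%R (returned r) <=
             size (matches (narrow q j `]-oo, v[) D))%N.
  apply: leq_trans (count_narrow _ _ vr ovf); apply: eq_leq; apply: eq_count => t.
  by rewrite in_itv.
case: ifP => [lt4 | /negbT].
  have szge : (count (fun t : point S => v <= t.2 j)%R (returned r) <=
               size (matches (narrow q j `[v, +oo[) D))%N.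
    apply: leq_trans (count_narrow _ _ vr ovf); apply: eq_leq.
    by apply: eq_count => t; rewrite in_itv /= andbT.
  have pq := perm_split2 q j v D.
  set qa := narrow _ _ _ in szlt pq *.
  set qb := narrow _ _ _ in szge pq *.
  have sq : (size (matches qa D) + size (matches qb D) = size (matches q D))%N.
    by rewrite -size_cat (perm_size pq).
  have lq : load q = load qa + load qb by rewrite /load -sq natrD mulrDl.
  have [_ sa] := IHN l qa le_l (determined_narrow det) ltac:(lia).
  have [_ sb] := IHN l qb le_l (determined_narrow det) ltac:(lia).
  have {}sa := settles_ask (sa lt_l ltac:(lia)).
  have {}sb := settles_ask (sb lt_l ltac:(lia)).
  exists (matches qa D ++ matches qb D) => //.
  by apply: settles_le (settles_cat sa sb); rewrite lq; lra.
rewrite -ltnNge => lt4.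
have sz1 : (count (fun t : point S => t.2 j \in `[v, v]) (returned r) <=
            size (matches (narrow q j `[v, v]) D))%N.
  exact: count_narrow vr ovf.
have csum : (count (fun t : point S => t.2 j <= v)%R (returned r) =
    count (fun t : point S => t.2 j < v)%R (returned r) +
    count (fun t : point S => t.2 j \in `[v, v]) (returned r))%N.
  elim: (returned r) => //= t s ->; rewrite in_itv /= -eq_le.
  by case: (ltgtP (t.2 j) v) => _ /=; lia.
have pq := perm_split3 q j v D.
set qa := narrow _ _ _ in szlt pq *; set qb := narrow _ _ _ in sz1 pq *.
set qc := narrow q j `]v, +oo[ in pq *.
have sq : (size (matches qa D) + (size (matches qb D) + size (matches qc D)) =
           size (matches q D))%N.
  by rewrite -!size_cat (perm_size pq).
have lq : load q = load qa + (load qb + load qc).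
  by rewrite /load -sq !natrD !mulrDl.
have [sa _] := IHN l qa le_l (determined_narrow det) ltac:(lia).
have [sb _] := IHN l.+1 qb (leqW le_l) (determined_narrow1 det lE) ltac:(lia).
have [sc _] := IHN l qc le_l (determined_narrow det) ltac:(lia).
(* At least [k / 2] returned values are at most [v] and fewer than [k / 4] are below it, so more
   than [k / 4] equal [v]. *)
have ub : 1 <= 4 * load qb by apply: size_load; lia.
exists (matches qa D ++ (matches qb D ++ matches qc D)) => //.
have := settles_cat (settles_ask sa) (settles_cat (settles_ask sb) (settles_ask sc)).
apply: settles_le; rewrite lq.
have -> : (ndim S - l)%:R = (ndim S - l.+1)%:R + 1 :> rat.
  by rewrite natr1 subnSK.
lra.
Qed.

(** * Descending through the categorical attributes *)

Definition wild (l : nat) (q : query S) : Prop :=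
  forall i : 'I_(ncat S), (l <= i)%N -> cat_pred q i = None.

Lemma wild_fix_cat l q i (x : 'I_(domsize i)) :
  wild l q -> l = i :> nat -> wild l.+1 (fix_cat q x).
Proof.
move=> wq li i' lt_li' /=; rewrite dfwith_out ?wq //; first exact: ltnW.
by rewrite -val_eqE /= -li; case: ltngtP lt_li'.
Qed.

Lemma determined_fix_cat l q i (x : 'I_(domsize i)) :
  wild l q -> l = i :> nat -> determined l q -> determined l.+1 (fix_cat q x).
Proof.
move=> wq li det t t'; have qi : cat_pred q i = None by apply: wq; rewrite li.
rewrite !satisfies_fix_cat // => /andP[st /eqP tx] /andP[st' /eqP tx'].
have [det1 det2] := det _ _ st st'; split=> [i'|j] lt_l.
  have [->|ne] := eqVneq i' i; first by rewrite tx tx'.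
  apply: det1; rewrite ltn_neqAle -ltnS lt_l andbT li.
  by rewrite -val_eqE in ne.
by have := ltn_ord i; lia.
Qed.

Lemma wild_full_query l : wild l (full_query S).
Proof. by []. Qed.

Lemma determined_full_query : determined 0 (full_query S).
Proof. by []. Qed.

Definition num_overflow (i : 'I_(ncat S)) : nat :=
  (\sum_(x : 'I_(domsize i)) overflow (tab (mk_slice x)))%N.

(** Queries charged per unit of load from level [l] on: one per overflowing slice of each remaining
    categorical attribute, then 20 per numeric dimension. *)
Definition rate (l : nat) : rat :=
  (\sum_(i < ncat S | (l <= i)%N) num_overflow i)%:R + 20 * (nnum S)%:R.

Lemma rate_ge0 l : 0 <= rate l.
Proof. by rewrite addr_ge0 // mulr_ge0 ?ler0n. Qed.

Lemma rateS (i : 'I_(ncat S)) : rate i = (num_overflow i)%:R + rate i.+1.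
Proof.
rewrite /rate addrA -natrD (bigD1 i) //=; congr ((_ + _)%:R + _).
by apply: eq_bigl => i'; rewrite ltn_neqAle andbC -val_eqE eq_sym.
Qed.

(** Every match of the child lies in the slice, so filtering the complete answer of the slice loses
    nothing. *)
Lemma slice_answers q i (x : 'I_(domsize i)) : cat_pred q i = None ->
  overflow (tab (mk_slice x)) = false ->
  perm_eq (matches (fix_cat q x) (returned (tab (mk_slice x))))
    (matches (fix_cat q x) D).
Proof.
move=> qi /(valid_response_resolved (tab_valid (mk_slice x))) pr.
suff <- : matches (fix_cat q x) (matches (slice_query (mk_slice x)) D) =
          matches (fix_cat q x) D by apply: perm_filter.
rewrite /matches -filter_predI; apply: eq_filter => t /=.
rewrite satisfies_fix_cat // /slice_query satisfies_fix_cat //=.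
by rewrite satisfies_full_query -andbA andbb.
Qed.

Lemma cat_child_settles l q i (x : 'I_(domsize i)) b :
  cat_pred q i = None -> 0 <= b -> solves (l.+1, fix_cat q x) b ->
  work_settles (cat_child tab l q x) (matches (fix_cat q x) D)
    ((overflow (tab (mk_slice x)))%:R + b).
Proof.
move=> qi b0 solv; rewrite /cat_child; case: ifP => ovf /=.
  by exists (matches (fix_cat q x) D) => //; apply: (settles_ask solv).
apply: work_settles_perm (slice_answers qi ovf) _.
by apply: work_settles_le (work_settles_output _); rewrite add0r.
Qed.

Lemma sum_load q i : cat_pred q i = None ->
  \sum_(x : 'I_(domsize i)) load (fix_cat q x) = load q.
Proof.
move=> qi; rewrite /load -mulr_suml -natr_sum.
by rewrite sum_size_matches_fix_cat.
Qed.

(** Induction on the number [n] of categorical attributes left. The loads of the children add up to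
    that of the node, so the costs below them sum to at most [load q * rate l.+1]. *)
Lemma solves_cat n l q : ncat S = (l + n)%N -> wild l q -> determined l q ->
  solves (l, q) (load q * rate l).
Proof.
elim: n l q => [|n IHn] l q lE wq det.
  rewrite addn0 in lE.
  have [solv _] := solves_numeric (eq_leq lE) det (leqnn _).
  apply: solves_le solv; rewrite /rate big_pred0 => [|i]; last first.
    by apply/negbTE; rewrite -ltnNge -lE.
  by rewrite /ndim lE addKn add0r mulrC.
have [le_k|lt_k] := leqP (size (matches q D)) k.
  apply: (@solves_le _ 0); first by rewrite mulr_ge0 ?load_ge0 ?rate_ge0.
  exact: solves_resolved.
have lt_l : (l < ncat S)%N by lia.
pose i := Ordinal lt_l; have qi : cat_pred q i = None by apply: wq.
move=> r vr; have ovf : overflow r.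
  by move: vr; rewrite /valid_response /= leqNgt lt_k => -[].
have insub_i : insub l = Some i by apply: insubT.
rewrite /expand ovf insub_i /=.
apply: work_settles_perm (perm_matches_fix_cat _ qi) _.
have children x : work_settles (cat_child tab l q x) (matches (@fix_cat S q i x) D)
    ((overflow (tab (mk_slice x)))%:R + load (fix_cat q x) * rate l.+1).
  apply: cat_child_settles => //; first by rewrite mulr_ge0 ?load_ge0 ?rate_ge0.
  by apply: IHn; [lia | apply: wild_fix_cat | apply: determined_fix_cat].
apply: work_settles_le (work_settles_merge _ children).
rewrite big_enum big_split /= -natr_sum -mulr_suml sum_load //.
have -> : load q * rate l = load q * (num_overflow i)%:R + load q * rate l.+1.
  by rewrite -mulrDr -(rateS i).
rewrite -/(num_overflow i) lerD2r.
(* An overflowing node has load at least 1, so the [num_overflow i] queries for its children fit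
   into [load q * num_overflow i]. *)
rewrite ler_peMl ?ler0n // /load ler_pdivlMr ?ltr0n // mul1r ler_nat.
exact: ltnW.
Qed.

(** Without categorical attributes the root is asked, hence the [1]. Otherwise the first level is
    answered by the slices, and charging starts at [rate 1]. *)
Lemma initial_work_settles :
  work_settles (initial_work k tab) D
    (if ncat S == 0%N then 1 + load (full_query S) * rate 0 else load (full_query S) * rate 1).
Proof.
rewrite /initial_work; case: eqP => [cat0|/eqP cat_gt0].
  rewrite insubN ?cat0 //; exists D => //.
  have := @solves_cat 0 0 (full_query S) cat0 (@wild_full_query 0) determined_full_query.
  by move=> /settles_ask; rewrite /= matches_full_query.
have lt0 : (0 < ncat S)%N by rewrite lt0n.
pose i := Ordinal lt0; have insub_i : insub 0%N = Some i by apply: insubT.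
rewrite insub_i -[X in work_settles _ X]matches_full_query.
have qi : cat_pred (full_query S) i = None by [].
apply: work_settles_perm (perm_matches_fix_cat _ qi) _.
have children (x : 'I_(domsize i)) :
    work_settles (expand k tab (1%N, fix_cat (full_query S) x) (tab (mk_slice x)))
      (matches (fix_cat (full_query S) x) D) (load (fix_cat (full_query S) x) * rate 1).
  apply: (@solves_cat (ncat S).-1 1); first by rewrite add1n prednK.
  - exact: wild_fix_cat.
  - by apply: determined_fix_cat => //; apply: determined_full_query.
  - exact: (tab_valid (mk_slice x)).
apply: work_settles_le (work_settles_merge _ children).
by rewrite big_enum -mulr_suml sum_load.
Qed.

Lemma num_overflow_le_domsize i : (num_overflow i <= domsize i)%N.
Proof.
rewrite -[X in (_ <= X)%N]card_ord -sum1_card.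
by apply: leq_sum => x _; apply: leq_b1.
Qed.

(** Each overflowing slice has load at least 1, and the slices of one attribute partition [D]. *)
Lemma num_overflow_le_load i : (num_overflow i)%:R <= load (full_query S).
Proof.
rewrite -(@sum_load _ i) // natr_sum; apply: ler_sum => x _.
case ovf: (overflow _); last exact: load_ge0.
have [/ltnW le_k _ _] := valid_response_overflow (tab_valid (mk_slice x)) ovf.
by rewrite /load ler_pdivlMr ?ltr0n // mul1r ler_nat.
Qed.

End Exploration.

(** * The slice phase followed by the exploration *)

Section Crawler.

Variables (S : data_space) (k : nat) (D : seq (point S)) (srv : server S).
Hypothesis srv_valid : valid_server k D srv.

(** The answers may depend on the slice phase [T], so the exploration is run against the server
    shifted by [T]. *)
Lemma crawler_explore (T h : history S) out c : size T = #|slice S| ->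
  run (explore k (slice_table T)) (fun h' => srv (T ++ h')) h out c ->
  run (crawler k) srv (T ++ h) out c.
Proof.
move=> sT; have crawlE h' : crawler k (T ++ h') = explore k (slice_table T) h'.
  rewrite /crawler drop_oversize; last by rewrite size_cat sT -cardE leq_addr.
  by rewrite take_size_cat // drop_size_cat.
elim=> {h out c} [h out Ah|h q out c Ah _ IH].
  by apply: run_output; rewrite crawlE.
by apply: (@run_ask _ _ _ _ q); rewrite ?crawlE // rcons_cat.
Qed.

(** The run is built backwards: any completion from [T] becomes a run from the empty history with
    [n] more queries. *)
Lemma slice_phase n : (n <= #|slice S|)%N ->
  exists T : history S,
    [/\ size T = n,
        forall p, (index p (enum (slice S)) < n)%N ->
          valid_response k D (slice_query p) (slice_table T p) &
        forall out c, run (crawler k) srv T out c ->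
          run (crawler k) srv [::] out (n + c)].
Proof.
elim: n => [|n IHn] lt_n; first by exists [::].
have [T [sT valT runT]] := IHn (ltnW lt_n).
case E: (drop n (enum (slice S))) => [|p s].
  by move/(congr1 size)/eqP: E; rewrite size_drop -cardE subn_eq0 leqNgt lt_n.
exists (rcons T (slice_query p, srv T (slice_query p))); split.
- by rewrite size_rcons sT.
- move=> p'; rewrite ltnS leq_eqVlt /slice_table /unzip2 map_rcons nth_rcons.
  rewrite size_map sT => /orP[/eqP ip'|lt_p'].
    rewrite ip' ltnn eqxx; suff -> : p' = p by apply: srv_valid.
    have <- : nth p (enum (slice S)) n = p.
      by rewrite -[n in nth _ _ n]addn0 -nth_drop E.
    by rewrite -ip' nth_index // mem_enum.
  by rewrite lt_p'; apply: valT.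
- move=> out c runh; rewrite addSnnS; apply/runT/(run_ask _ runh).
  by rewrite /crawler sT E.
Qed.

Lemma card_slice : #|slice S| = (\sum_(i < ncat S) domsize i)%N.
Proof.
rewrite card_tagged sumnE big_map big_enum; apply: eq_bigr => i _.
exact: card_ord.
Qed.

Hypothesis k_gt0 : (0 < k)%N.
Hypothesis D_le_k : forall t : point S, (count_mem t D <= k)%N.

(** [M] abstracts the numbers of overflowing slices. Attribute [0] is left out of the sum, as its
    level consists of slices already asked. *)
Lemma crawler_run : let r : rat := (size D)%:R / k%:R in
  exists (out : seq (point S)) (M : 'I_(ncat S) -> nat) c,
    [/\ run (crawler k) srv [::] out c, perm_eq out D,
        forall i, (M i)%:R <= Num.min (domsize i)%:R r &
        c%:R <= \sum_(i < ncat S) (domsize i)%:R +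
          (if ncat S == 0%N then 1 + r * (20 * (nnum S)%:R)
           else r * ((\sum_(i < ncat S | (0 < i)%N) M i)%:R + 20 * (nnum S)%:R))].
Proof.
move=> r; have [T [sT valT runT]] := slice_phase (leqnn _).
have tab_valid p : valid_response k D (slice_query p) (slice_table T p).
  by apply: valT; rewrite cardE index_mem mem_enum.
pose srv' h := srv (T ++ h).
have srv'_valid : valid_server k D srv' by move=> h q; apply: srv_valid.
have loadE : load k D (full_query S) = r by rewrite /load matches_full_query.
have [out [c [runs pout cb]]] :=
  explore_run (initial_work_settles k_gt0 D_le_k srv'_valid tab_valid).
exists out, (num_overflow (slice_table T)), (#|slice S| + c)%N; split=> //.
- by apply: runT; rewrite -[T]cats0; apply: crawler_explore.
- move=> i; rewrite le_min ler_nat num_overflow_le_domsize -loadE.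
  exact: num_overflow_le_load.
- rewrite natrD card_slice natr_sum lerD2l; apply: le_trans cb _.
  rewrite loadE; case: eqP => // cat0; rewrite /rate big_pred0 ?add0r // => i.
  by have := ltn_ord i; rewrite [X in (_ < X)%N]cat0.
Qed.

End Crawler.

(** The maximum with 1 in the numeric case covers the root query, which is asked even when [D] has
    fewer than [k] tuples. *)
Theorem theorem1 :
  exists (C : nat) (alg : forall (S : data_space) (k : nat), algorithm S),
  forall (S : data_space) (k : nat), (0 < ndim S)%N -> (0 < k)%N ->
  forall D : seq (point S), (forall t : point S, (count_mem t D <= k)%N) ->
  forall srv : server S, valid_server k D srv ->
  exists (out : seq (point S)) (c : nat),
    [/\ run (alg S k) srv [::] out c,
        perm_eq out D &
        let cost : rat := c%:R in
        let r : rat := (size D)%:R / k%:R in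
        [/\ (* 1 *) numeric S ->
              cost <= C%:R * ((ndim S)%:R * Num.max 1 r),
            (* 2 *) categorical S -> ncat S = 1%N ->
              forall i : 'I_(ncat S), cost <= (domsize i)%:R,
            (* 3 *) categorical S -> (1 < ncat S)%N ->
              cost <= r * (\sum_(i < ncat S) Num.min (domsize i)%:R r)
                      + \sum_(i < ncat S) (domsize i)%:R,
            (* 4 *) mixed S -> ncat S = 1%N ->
              forall i : 'I_(ncat S),
              cost <= (domsize i)%:R + C%:R * ((ndim S)%:R * r) &
            (* 5 *) mixed S -> (1 < ncat S)%N ->
              cost <= r * (\sum_(i < ncat S) Num.min (domsize i)%:R r)
                      + \sum_(i < ncat S) (domsize i)%:R
                      + C%:R * ((ndim S - ncat S)%:R * r)]].
Proof.
(* 20 is the price per numeric dimension and unit of load; one more absorbs the root query of the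
   numeric case. *)
exists 21%N, crawler => S k dim_gt0 k_gt0 D D_le_k srv srv_valid.
have [out [M [c [runs pout leM cb]]]] := crawler_run srv_valid k_gt0 D_le_k.
exists out, c; split=> // cost r; rewrite -/cost -/r in cb leM.
have r_ge0 : 0 <= r by rewrite divr_ge0.
have nnumE : (nnum S)%:R = (ndim S - ncat S)%:R :> rat by rewrite addKn.
have cat_case : (0 < ncat S)%N ->
    cost <= r * (\sum_(i < ncat S | (0 < i)%N) M i)%:R
      + \sum_(i < ncat S) (domsize i)%:R + 20 * ((ndim S - ncat S)%:R * r).
  rewrite lt0n => /negPf cat_gt0; move: cb; rewrite cat_gt0 nnumE; lra.
have sum_M : (\sum_(i < ncat S | (0 < i)%N) M i)%:R
    <= \sum_(i < ncat S) Num.min (domsize i)%:R r.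
  rewrite natr_sum big_mkcond; apply: ler_sum => i _; case: ifP => // _.
  by rewrite le_min ler0n.
have r_sum_M := ler_wpM2l r_ge0 sum_M.
have one_cat (i : 'I_(ncat S)) : ncat S = 1%N ->
    cost <= (domsize i)%:R + 20 * ((ndim S - ncat S)%:R * r).
  move=> cat1; have only_i i' : i' = i.
    by apply/val_inj => /=; have := ltn_ord i; have := ltn_ord i'; lia.
  have := cat_case (leq_ltn_trans (leq0n i) (ltn_ord i)).
  (* With a single categorical attribute, no level after the slices is left to charge. *)
  rewrite big_pred0 => [|i']; last first.
    by rewrite (only_i i'); have := ltn_ord i; lia.
  by rewrite (bigD1 i) //= big_pred0 => [|i']; rewrite ?(only_i i') ?eqxx //; lra.
split.
- move=> cat0; move: cb; rewrite [_ == _]cat0 big1 => [|i _]; last first.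
    by have := ltn_ord i; rewrite [X in (_ < X)%N](eqP cat0).
  rewrite nnumE (eqP cat0) subn0 add0r.
  have d1 : 1 <= (ndim S)%:R :> rat by rewrite ler1n.
  have m1 : 1 <= Num.max 1 r by rewrite le_max lexx.
  have mr : r <= Num.max 1 r by rewrite le_max lexx orbT.
  have := ler_wpM2l (ler0n _ (ndim S)) mr; have := ler_wpM2l (ler0n _ (ndim S)) m1.
  lra.
- move=> /eqP catE cat1 i; have := one_cat i cat1.
  by rewrite -catE subnn mul0r mulr0 addr0.
- move=> /eqP catE cat1; have := cat_case (ltnW cat1).
  by rewrite -catE subnn mul0r mulr0 addr0; lra.
- move=> _ cat1 i; have := one_cat i cat1.
  have : (ndim S - ncat S)%:R * r <= (ndim S)%:R * r.
    by rewrite ler_wpM2r // ler_nat leq_subr.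
  have : 0 <= (ndim S)%:R * r by rewrite mulr_ge0.
  lra.
- move=> _ cat1; have := cat_case (ltnW cat1).
  have : 0 <= (ndim S - ncat S)%:R * r by rewrite mulr_ge0.
  lra.
Qed.
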